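(* Let $\{C,D\}$ be a Kaprekar 2-cycle, and let $s$ be the smallest digit in the 2-cycle, i.e. the smallest among all digits of $C$ and of $D$. Then \begin{enumerate} \item $s$ appears the same number of times in $C$ and $D$, or \item $s$ appears exactly once in one of $C$, $D$ and not in the other. \end{enumerate} Moreover, if $s$ appears at least once as a digit in $D$, then the $\ell_c$-th digit of $D$ is $s$; and, correspondingly, if $s$ appears at least once as a digit in $C$, then the $\ell_d$-th digit of $C$ is $s$.
   Context: All integers are written in base 10. Fix a number of digits $n$; integers are written with exactly $n$ decimal digits, padded with leading zeros if necessary. For such an integer $N$, $\overline{N}$ and $\underline{N}$ denote the numbers obtained by writing the $n$ digits of $N$ in descending and ascending order respectively, and $k(N)=\overline{N}-\underline{N}$, again regarded as an $n$-digit number (padded with leading zeros if necessary). A Kaprekar 2-cycle is a pair $\{C,D\}$ of distinct $n$-digit integers (for some $n$) with $k(C)=D$ and $k(D)=C$. Digits are counted from the left: the first digit is the leading one. Write $\overline{C}=y_1y_2\cdots y_n$ and $\overline{D}=z_1z_2\cdots z_n$ in digits. Then $\ell_c$ denotes the maximal integer $\ell$ such that $y_\ell>y_{n+1-\ell}$, and $\ell_d$ the maximal integer $\ell$ such that $z_\ell>z_{n+1-\ell}$. *)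

(* Defs.v *)
From mathcomp Require Import all_boot.

Set Implicit Arguments.
Unset Strict Implicit.
Unset Printing Implicit Defensive.

(* Digits are counted from 1, starting at the leading digit of the n-digit
   (zero-padded) decimal writing of N; meaningful for 1 <= i <= n. *)
Definition digit (n N i : nat) : nat := (N %/ 10 ^ (n - i)) %% 10.

Definition digits (n N : nat) : seq nat := [seq digit n N i | i <- iota 1 n].

Definition value (s : seq nat) : nat := foldl (fun a d => 10 * a + d) 0 s.

Definition desc (n N : nat) : nat := value (sort geq (digits n N)).

Definition asc (n N : nat) : nat := value (sort leq (digits n N)).

(* The truncated subtraction is harmless, as asc n N <= desc n N. *)
Definition kaprekar (n N : nat) : nat := desc n N - asc n N.

Definition kaprekar_2cycle (n C D : nat) : Prop :=
  [/\ C < 10 ^ n, D < 10 ^ n, C <> D, kaprekar n C = D & kaprekar n D = C].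

(* The largest l with y_l > y_(n + 1 - l), where y_1 ... y_n are the digits of
   desc n N. The set of such l is empty (and ell n N is 0) only if all digits
   of N are equal; this never happens in a 2-cycle, since then kaprekar n N = 0
   and kaprekar n 0 = 0. *)
Definition ell (n N : nat) : nat :=
  \max_(1 <= l < n.+1 | digit n (desc n N) (n.+1 - l) < digit n (desc n N) l) l.

Definition smallest_digit (n C D s : nat) : Prop :=
  s \in digits n C ++ digits n D /\
  forall d, d \in digits n C ++ digits n D -> s <= d.

(* Main.v *)
(* Write y_1 >= ... >= y_n for the digits of C and l for ell n C. Subtracting
   y_n ... y_1 from y_1 ... y_n borrows from position k exactly when
   l <= k < n, so the digits of D = k(C) are y_k - y_(n+1-k) for k < l, one less
   than that at l, 9 + y_k - y_(n+1-k) for l < k < n and 10 + y_n - y_1 at n.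
   If no digit of C or D is below s, a digit s of D at a position k <> l forces
   k < n and y_k = s. Hence, a and b being the numbers of occurrences of s in C
   and D, b <= [the l-th digit of D is s] + max(a - 1, 0). This bound and the one
   with C and D exchanged give all the claims. *)
Require Import Defs.
From mathcomp Require Import all_boot.
From mathcomp Require Import zify.

(** * Decimal digits and values of digit sequences *)

Lemma value_rcons t d : value (rcons t d) = 10 * value t + d.
Proof. by rewrite /value -cats1 foldl_cat. Qed.

Lemma value0 t : all (pred1 0) t -> value t = 0.
Proof.
elim/last_ind: t => [|t d IH] //.
by rewrite all_rcons => /andP[/eqP-> /IH]; rewrite value_rcons => ->.
Qed.

Lemma size_digits n N : size (digits n N) = n.
Proof. by rewrite size_map size_iota. Qed.

Lemma digit_lt10 n N i : digit n N i < 10.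
Proof. exact: ltn_pmod. Qed.

Lemma digits_lt10 n N : all (gtn 10) (digits n N).
Proof. by apply/allP => _ /mapP[i _ ->]; apply: digit_lt10. Qed.

Lemma digitE n N i : 0 < i <= n -> digit n N i = nth 0 (digits n N) i.-1.
Proof.
move=> hi; rewrite /digits (nth_map 0) ?size_iota ?nth_iota; [|lia..].
by congr digit; lia.
Qed.

Lemma digits_value t : all (gtn 10) t -> digits (size t) (value t) = t.
Proof.
elim/last_ind: t => [|t d IH] //; rewrite all_rcons => /andP[/= ltd /IH Et].
rewrite value_rcons size_rcons /digits -[X in iota 1 X]addn1 iotaD map_cat cats1 /=.
congr rcons.
  rewrite -[RHS]Et /digits; apply/eq_in_map => i; rewrite mem_iota => hi.
  rewrite /digit subSn; last by lia.
  (* The extra factor 10 of the power strips the appended digit: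
     [(10 * value t + d) %/ 10 = value t], as [d < 10]. *)
  rewrite expnS divnMA; congr (_ %/ _ %% _).
  by lia.
by rewrite /digit add1n subnn divn1; lia.
Qed.

Lemma kaprekar_0 n : kaprekar n 0 = 0.
Proof.
rewrite /kaprekar /desc value0 //; apply/allP => d.
by rewrite mem_sort => /mapP[i _ ->]; rewrite /digit div0n mod0n.
Qed.

(** * The digits y_1 >= ... >= y_n of N *)

Definition sorted_digit n N i := nth 0 (sort geq (digits n N)) i.-1.

Lemma digit_desc n N i : 0 < i <= n -> digit n (desc n N) i = sorted_digit n N i.
Proof.
move=> hi; rewrite digitE // /sorted_digit; congr nth.
have := digits_value (sort geq (digits n N)).
by rewrite all_sort digits_lt10 size_sort size_digits => ->.
Qed.

Lemma sort_geqE n N :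
  sort geq (digits n N) = [seq sorted_digit n N i | i <- iota 1 n].
Proof.
apply: (@eq_from_nth _ 0) => [|i]; rewrite size_sort size_digits.
  by rewrite size_map size_iota.
by move=> lti; rewrite (nth_map 0) ?size_iota // nth_iota.
Qed.

Lemma sort_leqE n N :
  sort leq (digits n N) = [seq sorted_digit n N (n.+1 - i) | i <- iota 1 n].
Proof.
have -> : sort leq (digits n N) = rev (sort geq (digits n N)).
  apply: (@sorted_eq _ leq leq_trans anti_leq).
  - exact: sort_sorted leq_total _.
  - rewrite rev_sorted; apply: sort_sorted => x y; exact: leq_total.
  - by rewrite perm_sort perm_sym perm_rev perm_sort.
apply: (@eq_from_nth _ 0) => [|i]; rewrite size_rev size_sort size_digits.
  by rewrite size_map size_iota.
move=> lti; rewrite nth_rev ?size_sort size_digits // (nth_map 0) ?size_iota //.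
by rewrite nth_iota // /sorted_digit; congr nth; lia.
Qed.

Lemma sorted_digit_in n N i :
  0 < i <= n -> sorted_digit n N i \in digits n N.
Proof.
by move=> hi; rewrite -(mem_sort geq) mem_nth // size_sort size_digits; lia.
Qed.

Lemma sorted_digit_mono n N i j :
  0 < i -> i <= j <= n -> sorted_digit n N j <= sorted_digit n N i.
Proof.
move=> i0 hij.
have geq_trans : transitive geq by move=> x y z /= h1 h2; apply: leq_trans h2 h1.
have S : sorted geq (sort geq (digits n N)).
  by apply: sort_sorted => x y; exact: leq_total.
apply: (sorted_leq_nth geq_trans leqnn 0 S); rewrite ?inE ?size_sort ?size_digits; lia.
Qed.

Lemma sorted_digit_lt10 n N i : 0 < i <= n -> sorted_digit n N i < 10.
Proof. by move=> /(sorted_digit_in n N i) /(allP (digits_lt10 n N)). Qed.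

(** * The position l = [ell n N] *)

Lemma ell_max n N k : 0 < k <= n ->
  sorted_digit n N (n.+1 - k) < sorted_digit n N k -> k <= ell n N.
Proof.
move=> hk; rewrite -!digit_desc ?hk //; last by lia.
by move=> hlt; apply: (@leq_bigmax_seq _ _ _ id) => //; rewrite mem_index_iota; lia.
Qed.

Lemma ell_attained n N (l := ell n N) : 0 < l ->
  0 < l <= n /\ sorted_digit n N (n.+1 - l) < sorted_digit n N l.
Proof.
(* Being vacuous at 0, the value of the empty maximum, this predicate passes through [maxn]. *)
pose attained x := 0 < x ->
  0 < x <= n /\ sorted_digit n N (n.+1 - x) < sorted_digit n N x.
rewrite {}/l /ell big_nat_cond; apply: (@big_ind _ attained) => //.
  by move=> x y hx hy; rewrite /maxn; case: ifP.
move=> k /andP[hk]; rewrite !digit_desc; [|lia..].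
by move=> hlt; split => //; lia.
Qed.

(** At l = n the defining inequality would read y_1 < y_n. *)
Lemma ell_lt n N : 0 < ell n N -> ell n N < n.
Proof.
move=> /[dup] l0 /ell_attained[hl]; have [->|/eqP neq] := ell n N =P n; last by lia.
rewrite subSnn ltnNge sorted_digit_mono //; lia.
Qed.

Lemma sorted_digit_ell n N k : ell n N < k <= n ->
  sorted_digit n N k <= sorted_digit n N (n.+1 - k).
Proof. by move=> hk; rewrite leqNgt; apply/negP => /ell_max; lia. Qed.

(** Maximality of l = 0 applies to both k and n+1-k, so y_k = y_(n+1-k) and the two sorted lists
    coincide. *)
Lemma kaprekar_ell0 n N : ell n N = 0 -> kaprekar n N = 0.
Proof.
move=> l0; suff E : sort geq (digits n N) = sort leq (digits n N).
  by rewrite /kaprekar /desc /asc E subnn.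
rewrite sort_geqE sort_leqE; apply/eq_in_map => k; rewrite mem_iota => hk.
have := sorted_digit_ell n N k; have := sorted_digit_ell n N (n.+1 - k).
rewrite l0 subKn; lia.
Qed.

(** * Subtraction with borrows *)

Definition borrow n N k : nat := ell n N <= k < n.

(** Position k receives 10 from the borrow at k-1 and gives up 1 for the borrow at k. *)
Definition kaprekar_digit n N k :=
  10 * borrow n N k.-1 + sorted_digit n N k
  - (sorted_digit n N (n.+1 - k) + borrow n N k).

(** The equation says that the subtraction does not truncate. For k <= l, y_k >= y_l > y_(n+1-l) >=
    y_(n+1-k), so the difference survives the borrow at l. For k > l, y_k <= y_(n+1-k) keeps 9 + y_k
    - y_(n+1-k) below 10; at k = n, where 10 is added, y_n < y_1 is needed. *)
Lemma kaprekar_digit_spec n N k : 0 < ell n N -> 0 < k <= n ->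
  kaprekar_digit n N k < 10 /\
  kaprekar_digit n N k + (sorted_digit n N (n.+1 - k) + borrow n N k) =
  10 * borrow n N k.-1 + sorted_digit n N k.
Proof.
move=> l0 hk; have [hl hlt] := ell_attained _ _ l0; have hln := ell_lt _ _ l0.
have y10 := sorted_digit_lt10 n N k hk.
have z10 : sorted_digit n N (n.+1 - k) < 10 by apply: sorted_digit_lt10; lia.
rewrite /kaprekar_digit /borrow; case: (leqP k (ell n N)) => hkl.
  have h1 : sorted_digit n N (ell n N) <= sorted_digit n N k.
    by apply: sorted_digit_mono; lia.
  have h2 : sorted_digit n N (n.+1 - k) <= sorted_digit n N (n.+1 - ell n N).
    by apply: sorted_digit_mono; lia.
  have -> : (ell n N <= k.-1 < n) = false by lia.
  by case: (ell n N <= k < n) => /=; lia.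
have h1 := sorted_digit_ell n N k.
have -> : ell n N <= k.-1 < n by lia.
have [ltkn|gekn] := ltnP k n.
  by rewrite (ltnW hkl) /=; lia.
have Ek : k = n by lia.
have h2 : sorted_digit n N (ell n N) <= sorted_digit n N (n.+1 - k).
  by apply: sorted_digit_mono; lia.
have h3 : sorted_digit n N k <= sorted_digit n N (n.+1 - ell n N).
  by apply: sorted_digit_mono; lia.
by rewrite andbF /=; lia.
Qed.

Lemma digit_kaprekar n N k : 0 < ell n N -> 0 < k <= n ->
  digit n (kaprekar n N) k = kaprekar_digit n N k.
Proof.
move=> l0 hk; set d := kaprekar_digit n N.
(* Invariant of the subtraction on the leading j digits, with the pending borrow; that borrow is 0
   at j = 0 since l > 0, and at j = n. *)
have prefix j : j <= n -> value [seq d i | i <- iota 1 j] +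
    (value [seq sorted_digit n N (n.+1 - i) | i <- iota 1 j] + borrow n N j)
    = value [seq sorted_digit n N i | i <- iota 1 j].
  elim: j => [_|j IH ltj]; first by rewrite /borrow leqNgt l0.
  have [_] := kaprekar_digit_spec n N j.+1 l0 ltj.
  rewrite -[X in iota 1 X]addn1 iotaD !map_cat !cats1 !value_rcons add1n /= -/d.
  by have := IH (ltnW ltj); lia.
have {prefix} Ek : kaprekar n N = value [seq d i | i <- iota 1 n].
  have := prefix n (leqnn n); rewrite -sort_geqE -sort_leqE {1}/borrow ltnn andbF.
  by rewrite /kaprekar /desc /asc; lia.
rewrite digitE // Ek -[X in digits X](size_iota 1 n) -(size_map d) digits_value.
  rewrite (nth_map 0) ?size_iota ?nth_iota; [|lia..].
  by congr d; lia.
apply/allP => _ /mapP[i + ->]; rewrite mem_iota => hi.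
by have [|] := kaprekar_digit_spec n N i l0; [lia|].
Qed.

(** * Occurrences of the smallest digit *)

Lemma digit_in n N i : 0 < i <= n -> digit n N i \in digits n N.
Proof. by move=> hi; apply: map_f; rewrite mem_iota; lia. Qed.

(** Let D = [kaprekar n N], with digits d_k. For k < l, d_k >= y_l - y_(n+1-l) = d_l + 1 > s. For l
    < k < n, d_k = 9 + y_k - y_(n+1-k) >= y_k >= s, so d_k = s forces y_k = s. For k = n, d_n = 10 +
    y_n - y_1 > y_n >= s. *)
Lemma digit_kaprekar_min n N s k : 0 < ell n N ->
  (forall d, d \in digits n N -> s <= d) ->
  (forall d, d \in digits n (kaprekar n N) -> s <= d) ->
  0 < k <= n -> k != ell n N -> digit n (kaprekar n N) k = s ->
  k < n /\ sorted_digit n N k = s.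
Proof.
move=> l0 sN sD hk nekl; have [hl _] := ell_attained _ _ l0; have hln := ell_lt _ _ l0.
have := sD _ (digit_in n (kaprekar n N) _ hl).
rewrite !digit_kaprekar //.
have [_] := kaprekar_digit_spec n N _ l0 hl.
have [_] := kaprekar_digit_spec n N _ l0 hk.
have := sN _ (sorted_digit_in n N _ hk).
have : sorted_digit n N (n.+1 - k) < 10 by apply: sorted_digit_lt10; lia.
have [ltkl|] := ltnP k (ell n N).
  have : sorted_digit n N (ell n N) <= sorted_digit n N k.
    by apply: sorted_digit_mono; lia.
  have : sorted_digit n N (n.+1 - k) <= sorted_digit n N (n.+1 - ell n N).
    by apply: sorted_digit_mono; lia.
  rewrite /borrow leqnn hln.
  have -> : (ell n N <= (ell n N).-1 < n) = false by lia.
  have -> : (ell n N <= k.-1 < n) = false by lia.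
  have -> : (ell n N <= k < n) = false by lia.
  by move=> /=; lia.
rewrite /borrow => lekl.
have -> : (ell n N <= k.-1 < n) by lia.
by have [ltkn|gekn] := ltnP k n; rewrite lekl /=; lia.
Qed.

Lemma count_digits n N s :
  count_mem s (digits n N) = \sum_(1 <= k < n.+1) (sorted_digit n N k == s).
Proof.
have /permP <- : perm_eq (sort geq (digits n N)) (digits n N) by rewrite perm_sort.
by rewrite sort_geqE count_map -sum1_count big_mkcond /index_iota subn1.
Qed.

Lemma count_digits_kaprekar n N s : 0 < ell n N ->
  (forall d, d \in digits n N -> s <= d) ->
  (forall d, d \in digits n (kaprekar n N) -> s <= d) ->
  count_mem s (digits n (kaprekar n N)) <=
  (digit n (kaprekar n N) (ell n N) == s) + (count_mem s (digits n N)).-1.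
Proof.
move=> l0 sN sD; have [hl _] := ell_attained _ _ l0; have hln := ell_lt _ _ l0.
have n0 : 0 < n by lia.
rewrite [X in _ + X.-1]count_digits big_nat_recr //=.
set a := \sum_(_ <= _ < _) _.
(* Here [a] counts the k < n with y_k = s. If s occurs at all, the least digit y_n equals s and
   accounts for the missing occurrence. *)
have ha : a <= (a + (sorted_digit n N n == s)).-1.
  case: eqP => [_|ne] /=; first by lia.
  suff -> : a = 0 by [].
  rewrite /a big_nat_cond big1 // => k /andP[hk _]; case: eqP => // Ek.
  have := sN _ (sorted_digit_in n N n _); rewrite leqnn n0 => /(_ isT).
  by have := sorted_digit_mono n N k n; lia.
apply: leq_trans (leq_add (leqnn _) ha).
rewrite count_map -sum1_count big_mkcond /=.
(* Position l gives the first summand; every other occurrence is matched with a k < n such that y_k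
   = s. *)
rewrite (bigD1_seq (ell n N)) ?iota_uniq ?mem_iota //=.
apply: leq_add; first by case: eqP.
have -> : iota 1 n = index_iota 1 n.+1 by rewrite /index_iota subn1.
rewrite big_nat_cond big_mkcond big_nat_recr //= -[a]addn0.
have pointwise k : (if (0 < k < n.+1) && (k != ell n N)
    then if digit n (kaprekar n N) k == s then 1 else 0 else 0)
    <= (k < n) && (sorted_digit n N k == s).
  case: ifP => // /andP[hk nekl]; case: eqP => // Ek.
  by have [-> ->] := digit_kaprekar_min n N s k l0 sN sD hk nekl Ek; rewrite eqxx.
apply: leq_add; last by have := pointwise n; rewrite ltnn.
rewrite /a; apply: leq_sum => k _; apply: leq_trans (pointwise k) _.
by case: (_ < _).
Qed.

Lemma kaprekar_2cycle_ell_gt0 n C D : kaprekar_2cycle n C D -> 0 < ell n C.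
Proof.
move=> [_ _ neq ED EC]; rewrite lt0n; apply/eqP => /kaprekar_ell0 E.
by apply: neq; rewrite -EC -ED E kaprekar_0.
Qed.

Theorem theorem4p1 (n C D s : nat)
    (hCD : kaprekar_2cycle n C D) (hs : smallest_digit n C D s) :
  [/\ count_mem s (digits n C) = count_mem s (digits n D) \/
      ((count_mem s (digits n C) = 1 /\ s \notin digits n D) \/
       (count_mem s (digits n D) = 1 /\ s \notin digits n C)),
      s \in digits n D -> digit n D (ell n C) = s &
      s \in digits n C -> digit n C (ell n D) = s].
Proof.
have lC := kaprekar_2cycle_ell_gt0 _ _ _ hCD.
have lD : 0 < ell n D.
  by case: hCD => ? ? /nesym ? ? ?; apply: (kaprekar_2cycle_ell_gt0 _ _ C).
have [_ _ _ ED EC] := hCD; have [_ smin] := hs.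
have sC d : d \in digits n C -> s <= d.
  by move=> hd; apply: smin; rewrite mem_cat hd.
have sD d : d \in digits n D -> s <= d.
  by move=> hd; apply: smin; rewrite mem_cat hd orbT.
have := count_digits_kaprekar n C s lC sC; rewrite ED => /(_ sD).
have := count_digits_kaprekar n D s lD sD; rewrite EC => /(_ sC).
(* Let a, b be the counts of s in C and D. If both are positive, the bounds give b <= a <= b; if one
   is 0, the other is at most 1. If b > 0 but the l-th digit of D is not s, then b <= a - 1 while a
   <= b, a contradiction; likewise with C and D exchanged. *)
rewrite -!has_pred1 !has_count.
by split; lia.
Qed.
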